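(* Consider the linear regression model $X_k=\theta\phi_k+\varepsilon_k$, $k=1,\dots,n$, where $\theta\in\mathbb{R}$ is an unknown parameter, $(\phi_k)_{k=1,\dots,n}$ is a sequence of independent random variables, $(\varepsilon_k)_{k=1,\dots,n}$ is a sequence of martingale differences with respect to its natural filtration, and $(\phi_k)$ and $(\varepsilon_k)$ are independent. Let $\theta_n=\sum_{k=1}^n\phi_kX_k\big/\sum_{k=1}^n\phi_k^2$. Let $p\ge2$ and $\delta>0$, and assume that for constants $A$ and $B$, $$\mathbf{E}\big[\varepsilon_i^2\,\big|\,\sigma\{\varepsilon_j,j\le i-1\}\big]\le A\quad\text{and}\quad\mathbf{E}\big[|\varepsilon_i|^{p+\delta}\big]\le B$$ for all $i\in[1,n]$. Then for all $x>0$, for each choice of sign $\pm$, $$\mathbf{P}\Big(\pm(\theta_n-\theta)\sqrt{\textstyle\sum_{k=1}^n\phi_k^2}\ge x\Big)\le\exp\Bigg\{-\frac{x^2}{2\big(A+\frac13x^{(2p+\delta)/(p+\delta)}\big)}\Bigg\}+\frac{B}{x^p}.$$ In particular, for any $x>0$ there is $c_x>0$ not depending on $n$ such that $$\mathbf{P}\Big(\pm(\theta_n-\theta)\sqrt{\textstyle\sum_{k=1}^n\phi_k^2}\ge\sqrt n\,x\Big)=O\Big(\frac{c_x}{n^{p/2}}\Big),\quad n\to\infty.$$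
   Context: It is implicitly assumed that $\sum_{k=1}^n\phi_k^2>0$ almost surely, so that $\theta_n$ is well defined. *)

(* Defs.v *)
From HB Require Import structures.
From mathcomp Require Import all_boot all_order all_algebra.
From mathcomp Require Import all_classical all_reals all_analysis.
Set Implicit Arguments. Unset Strict Implicit. Unset Printing Implicit Defensive.
Import Order.TTheory GRing.Theory Num.Theory.
Import numFieldNormedType.Exports.
Local Open Scope classical_set_scope.
Local Open Scope ring_scope.

Section Defs.
Context {d : measure_display} {T : measurableType d} {R : realType}.

Definition sigma_gen (f : nat -> T -> R) (I : set nat) : set (set T) :=
  <<s setT, \bigcup_(j in I) [set (f j) @^-1` B | B in [set B : set R | measurable B]] >>.

Definition Ssq (phi : nat -> T -> R) (n : nat) (w : T) : R :=
  \sum_(1 <= k < n.+1) phi k w ^+ 2.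

Definition Xobs (theta : R) (phi eps : nat -> T -> R) (k : nat) (w : T) : R :=
  theta * phi k w + eps k w.

Definition theta_hat (theta : R) (phi eps : nat -> T -> R) (n : nat) (w : T) : R :=
  (\sum_(1 <= k < n.+1) phi k w * Xobs theta phi eps k w) / Ssq phi n w.

Local Open Scope ereal_scope.

Definition model_hyps (P : probability T R) (phi eps : nat -> T -> R)
    (p delta A B : R) (n : nat) : Prop :=
  (forall k, (1 <= k <= n)%N -> measurable_fun setT (phi k)) /\
  (forall k, (1 <= k <= n)%N -> measurable_fun setT (eps k)) /\
  (forall Bs : nat -> set R, (forall k, measurable (Bs k)) ->
     P (\bigcap_(k in `[1%N, n]) (phi k @^-1` Bs k)) =
     \prod_(1 <= k < n.+1) P (phi k @^-1` Bs k)) /\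
  (forall F G, sigma_gen phi `[1%N, n] F -> sigma_gen eps `[1%N, n] G ->
     P (F `&` G) = P F * P G) /\
  (* martingale differences w.r.t. the natural filtration of eps *)
  (forall i, (1 <= i <= n)%N ->
     P.-integrable setT (fun w => (eps i w)%:E) /\
     forall G, sigma_gen eps `[1%N, i[ G ->
       \int[P]_(w in G) (eps i w)%:E = 0) /\
  (* E[eps_i^2 | sigma(eps_j, j <= i-1)] <= A  a.s. *)
  (forall i, (1 <= i <= n)%N ->
     forall G, sigma_gen eps `[1%N, i[ G ->
       \int[P]_(w in G) (eps i w ^+ 2)%:E <= A%:E * P G) /\
  (forall i, (1 <= i <= n)%N ->
     \int[P]_w (`|eps i w| `^ (p + delta))%:E <= B%:E) /\
  {ae P, forall w, (0 < Ssq phi n w)%R}.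

End Defs.

(* Main.v *)
(** By independence, the noise may be integrated with the design frozen, so it
    suffices to bound the tail of [S = \sum_k c_k eps_k] for constants with
    [\sum_k c_k ^ 2 = 1], where [c_k = +- phi_k / sqrt (\sum_j phi_j ^ 2)].
    Cut the summands [c_k eps_k] exceeding [y = x ^ (p / (p + delta))] down to [0].
    Bernstein's inequality [e^u <= 1 + u + u ^ 2 / (2 (1 - b / 3))] for [u <= b < 3]
    shows that the cut summands have conditional exponential moments bounded in
    terms of [A c_k ^ 2], hence that the cut sum has a Bernstein tail; optimizing
    the exponent gives the first term, as [x y = x ^ ((2 p + delta) / (p + delta))].
    Markov's inequality and [\sum_k |c_k| ^ (p + delta) <= 1] bound the probability
    that some summand is cut by [B / y ^ (p + delta) = B / x ^ p]. Substituting
    [sqrt n x] for [x], the exponential term decays faster than any power of [n]. *)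

Require Import Defs.
From HB Require Import structures.
From mathcomp Require Import all_boot all_order all_algebra.
From mathcomp Require Import all_classical all_reals all_analysis.
From mathcomp Require Import measurable_realfun ring lra.
Import Order.TTheory GRing.Theory Num.Theory.
Import numFieldNormedType.Exports.
Local Open Scope classical_set_scope.
Local Open Scope ring_scope.

(** * Exponential inequalities of Bernstein type and the one-sided cut *)

Lemma exp_coeff_series_le {R : realType} (x : R) (n : nat) :
  0 <= x -> series (exp_coeff x) n <= expR x.
Proof.
move=> x0; apply: nondecreasing_cvgn_le; last exact: is_cvg_series_exp_coeff.
by apply: nondecreasing_series => k _ _; exact: exp_coeff_ge0.
Qed.

(** The bound is the inverse of [1 - x + x ^ 2 / 2 <= expR (- x)], a partial sum with nonnegative
    terms, because [(1 + x + x ^ 2 / 2) (1 - x + x ^ 2 / 2) = 1 + x ^ 4 / 4 >= 1]. *)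
Lemma expR_le1DxD2 {R : realType} (x : R) :
  x <= 0 -> expR x <= 1 + x + x ^+ 2 / 2.
Proof.
move=> x0.
have x'0 : 0 <= - x by rewrite oppr_ge0.
have := exp_coeff_series_le _ 3 x'0.
rewrite /series /= !big_nat_recr //= big_geq // /exp_coeff /= !factS fact0.
rewrite !expr0 !expr1 => h.
rewrite -[expR x]invrK -expRN -[X in _ <= X]invrK lef_pV2 ?posrE ?expR_gt0//;
  last by rewrite invr_gt0; nra.
apply: le_trans h.
rewrite -[X in X <= _]mul1r ler_pdivrMr; last by nra.
have -> : (0 + 1 / (1%:R) + - x / (1 * 1)%:R + (- x) ^+ 2 / (2 * (1 * 1))%:R)
    = 1 - x + x ^+ 2 / 2 :> R.
  by rewrite !muln1; field.
nra.
Qed.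

Lemma fact_ge_geom (n : nat) : (2 * 3 ^ n <= n.+2`!)%N.
Proof.
elim: n => [//|n IHn]; rewrite factS expnS mulnCA.
exact: (@leq_mul 3 _ n.+3).
Qed.

(* The series is compared with a geometric one through [2 * 3 ^ n <= (n + 2)!]. *)
Lemma expR_bernstein_ge0 {R : realType} (x : R) :
  0 <= x < 3 -> expR x <= 1 + x + x ^+ 2 / (2 * (1 - x / 3)).
Proof.
move=> /andP[x0 x3].
have d0 : 0 < 1 - x / 3 by lra.
(* The factor [1 - (x / 3) ^+ n] makes the last term an exact partial sum of the geometric series of
   ratio [x / 3], so the induction closes with an equality. *)
have partial n : series (exp_coeff x) n.+2 <=
    1 + x + x ^+ 2 / (2 * (1 - x / 3)) * (1 - (x / 3) ^+ n).
  elim: n => [|n IHn].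
    rewrite /series /= !big_nat_recr //= big_geq // /exp_coeff /= !factS fact0.
    by rewrite !expr0 !expr1 subrr mulr0 !muln1 !divr1 add0r addr0.
  rewrite /series /= big_nat_recr //=.
  apply: le_trans (lerD IHn (_ : _ <= x ^+ 2 / 2 * (x / 3) ^+ n)) _.
    rewrite /exp_coeff /= expr_div_n mulrACA -invfM -(exprD x 2 n).
    rewrite ler_wpM2l ?exprn_ge0// lef_pV2 ?posrE.
    - by rewrite -natrX -natrM ler_nat fact_ge_geom.
    - by rewrite ltr0n fact_gt0.
    - by rewrite mulr_gt0// exprn_gt0.
  rewrite le_eqVlt; apply/orP; left; apply/eqP.
  rewrite [(x / 3) ^+ n.+1]exprS; set t := (x / 3) ^+ n.
  field.
  by apply/eqP => h; move: d0; lra.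
apply: limr_le; first exact: is_cvg_series_exp_coeff.
exists 2%N => // -[|[|n]]//= _; apply: le_trans (partial n) _.
rewrite lerD2l ler_piMr// ?divr_ge0 ?exprn_ge0 ?mulr_ge0 ?(ltW d0)//.
by rewrite gerBl exprn_ge0 ?divr_ge0.
Qed.

(** For [x >= 0] the denominator only shrinks when [x] is replaced by [b]; for [x < 0] the
    coefficient [1 / 2] already suffices, as [1 - b / 3 <= 1]. Only an upper bound on [x] is thus
    required. *)
Lemma expR_bernstein {R : realType} (x b : R) :
  x <= b -> 0 <= b < 3 -> expR x <= 1 + x + x ^+ 2 / (2 * (1 - b / 3)).
Proof.
move=> xb /andP[b0 b3].
have d0 : 0 < 1 - b / 3 by lra.
have [x0|x0] := leP 0 x.
  apply: le_trans (expR_bernstein_ge0 _ _) _; first by rewrite x0 (le_lt_trans xb).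
  rewrite lerD2l ler_wpM2l ?exprn_ge0// lef_pV2 ?posrE; lra.
apply: le_trans (expR_le1DxD2 _ (ltW x0)) _.
rewrite lerD2l ler_wpM2l ?sqr_ge0// lef_pV2 ?posrE; lra.
Qed.

(** The cut is one-sided: large negative values are kept, since the exponential inequality only asks
    for an upper bound. *)
Definition cutoff {R : realType} (y u : R) : R := if u <= y then u else 0.

(** The right side involves the uncut [u], so that the martingale property later kills its linear
    term. Above the level [y] the left side is [1], and the linear and quadratic terms are
    nonnegative. *)
Lemma expR_cutoff_le {R : realType} (l y u : R) :
  0 < l -> 0 < y -> l * y < 3 ->
  expR (l * cutoff y u) <= 1 + l * u + l ^+ 2 / (2 * (1 - l * y / 3)) * u ^+ 2.
Proof.
move=> l0 y0 ly; have ly0 : 0 < l * y by exact: mulr_gt0.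
have d0 : 0 < 1 - l * y / 3 by lra.
rewrite [_ / _ * _]mulrAC -exprMn /cutoff; case: (leP u y) => uy.
  by apply: expR_bernstein; rewrite ?ler_pM2l// ltW.
rewrite mulr0 expR0 -addrA lerDl addr_ge0//.
  by rewrite mulr_ge0 ?ltW// (lt_trans y0).
by rewrite divr_ge0 ?sqr_ge0// mulr_ge0// ltW.
Qed.


(** * Integration of finite sums, comparison of integrals over a sub-sigma-algebra, and
    independence *)

Lemma integral_probability_cst d (T : measurableType d) (R : realType)
  (P : probability T R) (K : \bar R) : (\int[P]_w K = K)%E.
Proof.
by rewrite integral_cst// [X in (_ * X)%E](_ : _ = 1%E) ?mule1//;
  exact: probability_setT.
Qed.

Lemma measurable_sum_nat d (T : measurableType d) (R : realType)
    (h : nat -> T -> R) (m n : nat) :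
  (forall k, (m <= k < n)%N -> measurable_fun setT (h k)) ->
  measurable_fun setT (fun x => \sum_(m <= k < n) h k x).
Proof.
move=> mh; apply: (@eq_measurable_fun _ _ _ _ _ (fun x =>
    \sum_(k <- index_iota m n) if (m <= k < n)%N then h k x else 0)).
  by move=> x _; apply: eq_big_nat => k kmn; rewrite kmn.
by apply: measurable_sum => k; have [/mh//|_] := boolP (m <= k < n)%N.
Qed.

Lemma ge0_integral_sum_nat d (T : measurableType d) (R : realType)
    (mu : {measure set T -> \bar R}) (h : nat -> T -> \bar R) (m n : nat) :
  (forall k, (m <= k < n)%N -> measurable_fun setT (h k)) ->
  (forall k w, (0 <= h k w)%E) ->
  (\int[mu]_w (\sum_(m <= k < n) h k w) = \sum_(m <= k < n) \int[mu]_w h k w)%E.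
Proof.
move=> mh h0; pose g k w := if (m <= k < n)%N then h k w else 0%E.
transitivity (\int[mu]_w (\sum_(m <= k < n) g k w))%E.
  by apply: eq_integral => w _; apply: eq_big_nat => k kmn; rewrite /g kmn.
rewrite ge0_integral_sum//.
- apply: eq_big_nat => k kmn.
  by apply: eq_integral => w _; rewrite /g kmn.
- by move=> k; rewrite /g; have [/mh//|_] := boolP (m <= k < n)%N.
- by move=> k w _; rewrite /g; case: ifPn.
Qed.

Section sub_sigma_algebra.
Context d (T : measurableType d) (R : realType) (P : probability T R).
Implicit Types (G : set (set T)) (h W : T -> R).
Local Open Scope ereal_scope.

Lemma measurable_fun_sub_sigma G (f : T -> R) :
  <<s G >> `<=` measurable ->
  measurable_fun setT (f : g_sigma_algebraType G -> R) -> measurable_fun setT f.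
Proof. by move=> sG mf _ B mB; apply: sG; exact: mf. Qed.

Import HBNNSimple.

Lemma ge0_integral_nnsfunM G (f : {nnsfun g_sigma_algebraType G >-> R}) h :
  <<s G >> `<=` measurable ->
  measurable_fun setT h -> (forall w, (0 <= h w)%R) ->
  \int[P]_w ((f w)%:E * (h w)%:E) =
  \sum_(k \in range f) k%:E * \int[P]_(w in f @^-1` [set k]) (h w)%:E.
Proof.
move=> sG mh h0.
have mf k : d.-measurable (f @^-1` [set k] : set T).
  by apply: sG; exact: (measurable_funPTI f (measurable_set1 k)).
under eq_integral => w _.
  rewrite fimfunE -fsumEFin// muleC ge0_mule_fsumr; last first.
    by move=> r; rewrite EFinM nnfun_muleindic_ge0.
  over.
rewrite ge0_integral_fsum//; last 2 first.
- move=> r; apply/measurable_EFinP; apply: measurable_funM => //.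
  by apply: measurable_funM => //; exact: measurable_indic.
- move=> r w _; rewrite mule_ge0 ?lee_fin//.
  by rewrite -lee_fin EFinM nnfun_muleindic_ge0.
apply: eq_fsbigr => r /[!inE] -[w _ <-].
rewrite [in RHS]integral_mkcond -ge0_integralZl//.
- apply: eq_integral => v _; rewrite epatch_indic muleC EFinM -muleA.
  by congr (_ * _); rewrite muleC.
- rewrite epatch_indic.
  apply: emeasurable_funM; first exact/measurable_EFinP.
  by apply/measurable_EFinP; exact: measurable_indic.
- by move=> v _; rewrite epatch_indic mule_ge0// lee_fin.
- by rewrite lee_fin.
Qed.

(** This is the tower property for a conditional inequality, with integrals over the sets of the
    sub-sigma-algebra in place of conditional expectations. A simple [W] splits along its level
    sets, which lie in [<<s G >>]; the general case follows by monotone convergence. *)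
Lemma ge0_le_integral_sigma G h1 h2 W :
  <<s G >> `<=` measurable ->
  measurable_fun setT h1 -> measurable_fun setT h2 ->
  (forall w, (0 <= h1 w)%R) -> (forall w, (0 <= h2 w)%R) ->
  (forall A, <<s G >> A ->
    \int[P]_(w in A) (h1 w)%:E <= \int[P]_(w in A) (h2 w)%:E) ->
  measurable_fun setT (W : g_sigma_algebraType G -> R) ->
  (forall w, (0 <= W w)%R) ->
  \int[P]_w (W w * h1 w)%:E <= \int[P]_w (W w * h2 w)%:E.
Proof.
move=> sG mh1 mh2 h10 h20 h12 mW W0.
have mWE : measurable_fun setT (EFin \o W : g_sigma_algebraType G -> \bar R).
  exact/measurable_EFinP.
pose f := nnsfun_approx (@measurableT _ (g_sigma_algebraType G)) mWE.
have mf n : measurable_fun setT (f n : T -> R).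
  by apply: (@measurable_fun_sub_sigma G _ sG); exact: measurable_funP.
have ndf h w : (forall w, (0 <= h w)%R) ->
    {homo (fun n => (f n w)%:E * (h w)%:E) : m n / (m <= n)%N >-> m <= n}.
  move=> h0 m n mn; rewrite lee_wpmul2r// lee_fin//.
  exact/lefP/nd_nnsfun_approx.
have cvg_f h : measurable_fun setT h -> (forall w, (0 <= h w)%R) ->
    \int[P]_w ((f n w)%:E * (h w)%:E) @[n --> \oo] --> \int[P]_w (W w * h w)%:E.
  move=> mh h0.
  rewrite (_ : (fun w => _) = (fun w => limn (fun n => (f n w)%:E * (h w)%:E))).
    apply: cvg_monotone_convergence => //.
    - by move=> n; apply: emeasurable_funM; exact/measurable_EFinP.
    - by move=> n w _; rewrite mule_ge0// lee_fin.
    - by move=> w _; exact: ndf.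
  apply/funext => w; apply/esym/cvg_lim => //; rewrite EFinM.
  apply: cvgeZr => //.
  by apply: cvg_nnsfun_approx => //= v _; rewrite lee_fin.
apply: (lee_cvg_to (cvg_f _ mh1 h10) (cvg_f _ mh2 h20)).
apply: nearW => n.
rewrite !ge0_integral_nnsfunM//; apply: lee_fsum => // k [w _ <-].
rewrite lee_wpmul2l ?lee_fin//; apply: h12.
exact: (measurable_funPTI (f n) (measurable_set1 (f n w))).
Qed.

(* Pushing [P] forward to the diagonal of the two sub-sigma-algebras gives their
   product measure, so the second coordinate can be integrated with the first frozen. *)
Lemma independent_sigma_diag_le (G1 G2 : set (set T))
    (E : set (g_sigma_algebraType G1 * g_sigma_algebraType G2)) (K : \bar R) :
  <<s G1 >> `<=` measurable -> <<s G2 >> `<=` measurable ->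
  (forall A B, <<s G1 >> A -> <<s G2 >> B -> P (A `&` B) = P A * P B) ->
  measurable E ->
  (forall u, P [set v | E (u, v)] <= K) ->
  P [set w | E (w, w)] <= K.
Proof.
move=> s1 s2 indep mE EK.
have mid G : <<s G >> `<=` measurable ->
    measurable_fun setT (id : T -> g_sigma_algebraType G).
  by move=> sG _ B mB; rewrite setTI preimage_id; exact: sG.
pose id1 : {mfun T >-> g_sigma_algebraType G1} :=
  HB.pack (id : T -> g_sigma_algebraType G1)
    (isMeasurableFun.Build _ _ _ _ _ (mid _ s1)).
pose id2 : {mfun T >-> g_sigma_algebraType G2} :=
  HB.pack (id : T -> g_sigma_algebraType G2)
    (isMeasurableFun.Build _ _ _ _ _ (mid _ s2)).
have mdiag : measurable_fun setT
    (fun w : T => (w, w) : g_sigma_algebraType G1 * g_sigma_algebraType G2).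
  exact: (measurable_fun_pair (mid _ s1) (mid _ s2)).
pose diag : {mfun T >-> (g_sigma_algebraType G1 * g_sigma_algebraType G2)%type} :=
  HB.pack (fun w : T => (w, w) : g_sigma_algebraType G1 * g_sigma_algebraType G2)
    (isMeasurableFun.Build _ _ _ _ _ mdiag).
have K0 : 0 <= K by apply: le_trans (EK point); exact: measure_ge0.
have -> : P [set w | E (w, w)] = distribution P diag E by [].
(* The two measures agree on rectangles, which is exactly the independence hypothesis. *)
have <- : (distribution P id1 \x distribution P id2) E = distribution P diag E.
  by apply: product_measure_unique => // A B mA mB; exact: indep.
apply: (@le_trans _ _ (\int[distribution P id1]_u (cst K) u)).
  apply: ge0_le_integral => //; first exact: measurable_fun_xsection.
  by move=> u _; rewrite /= xsectionE; exact: EK.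
by rewrite integral_probability_cst.
Qed.

End sub_sigma_algebra.

(** * Exponential moments and tails of weighted sums of martingale differences *)

(** Pointwise form of the union of two events. If no [u k] exceeds [y], the cut changes nothing and
    the exponential term is at least [1]; otherwise some [u k > y] contributes a power at least
    [1]. *)
Lemma one_le_exp_tail {R : realType} (u : nat -> R) (x l y q : R) (n : nat) :
  0 < l -> 0 < y -> 0 <= q -> x <= \sum_(1 <= k < n.+1) u k ->
  1 <= expR (- (l * x)) * expR (l * \sum_(1 <= k < n.+1) cutoff y (u k))
       + \sum_(1 <= k < n.+1) (`|u k| / y) `^ q.
Proof.
move=> l0 y0 q0 xu.
have s0 (s : seq nat) : 0 <= \sum_(k <- s) (`|u k| / y) `^ q.
  by apply: sumr_ge0 => k _; exact: powR_ge0.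
have [small|/allPn[k kn]] := boolP (all (fun k => u k <= y) (index_iota 1 n.+1)).
  have -> : \sum_(1 <= k < n.+1) cutoff y (u k) = \sum_(1 <= k < n.+1) u k.
    by apply: eq_big_seq => k kn; rewrite /cutoff (allP small).
  rewrite -expRD -[X in X <= _]addr0 lerD//.
  by rewrite -expR0 ler_expR addrC subr_ge0 ler_pM2l.
rewrite -ltNge => yu; rewrite -[X in X <= _]add0r lerD//.
rewrite (big_rem k)//= -[X in X <= _]addr0 lerD//.
rewrite -(powRr0 (`|u k| / y)) ler_powR// ler_pdivlMr// mul1r.
by rewrite (le_trans (ltW yu))// ler_norm.
Qed.

(* [sigma_gen f I] is [<<s sigma_gens f I >>]; the generators are named so that
   [g_sigma_algebraType] can be applied to them. *)
Definition sigma_gens {d} {T : measurableType d} {R : realType}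
    (f : nat -> T -> R) (I : set nat) : set (set T) :=
  \bigcup_(j in I) [set (f j) @^-1` B | B in [set B : set R | measurable B]].

Section bounded_conditional_variance.
Context d (T : measurableType d) (R : realType) (P : probability T R).
Implicit Types (e : T -> R) (eps : nat -> T -> R) (G : set T).
Local Open Scope ereal_scope.

Lemma measurable_cutoff (y : R) : measurable_fun setT (cutoff y).
Proof.
apply: measurable_fun_ifT => //.
by apply: measurable_fun_ler.
Qed.

(** One conditional step: integrating [expR_cutoff_le] over [G] removes the linear term, the
    variance bound controls the quadratic one, and [1 + t <= expR t] restores an exponential. *)
Lemma integral_expR_cutoff_le e G (A c l y : R) :
  (0 < l)%R -> (0 < y)%R -> (l * y < 3)%R ->
  measurable G -> P.-integrable setT (EFin \o e) ->
  \int[P]_(w in G) (e w)%:E = 0 ->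
  \int[P]_(w in G) (e w ^+ 2)%:E <= A%:E * P G ->
  \int[P]_(w in G) (expR (l * cutoff y (c * e w)))%:E <=
  \int[P]_(w in G) (expR (l ^+ 2 / (2 * (1 - l * y / 3)) * A * c ^+ 2))%:E.
Proof.
move=> l0 y0 ly mG ie e0 e2.
set g := (l ^+ 2 / _)%R.
have g0 : (0 <= g)%R.
  by rewrite divr_ge0 ?sqr_ge0// mulr_ge0//; lra.
have me : measurable_fun setT e.
  by apply/measurable_EFinP; case/integrableP : ie.
have mce : measurable_fun setT (fun w => c * e w)%R by exact: measurable_funM.
have ie' : P.-integrable G (EFin \o e) by exact: integrableS ie.
(* Square integrability on [G] comes from the variance bound itself, as [A * P G] is finite. *)
have ie2 : P.-integrable G (fun w => (e w ^+ 2)%:E).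
  apply/integrableP; split.
    by apply/measurable_EFinP/measurable_funTS/measurable_funX.
  apply: le_lt_trans (_ : A%:E * P G < +oo); last first.
    by rewrite -(fineK (fin_num_measure P G mG)) -EFinM ltry.
  by under eq_integral do rewrite gee0_abs ?lee_fin ?sqr_ge0//.
have PG : P G \is a fin_num by exact: fin_num_measure.
have i1 : P.-integrable G (cst 1) by exact: finite_measure_integrable_cst.
have split_quad : \int[P]_(w in G) (1 + ((l * c)%:E * (e w)%:E
      + (g * c ^+ 2)%:E * (e w ^+ 2)%:E)) =
    P G + (g * c ^+ 2)%:E * \int[P]_(w in G) (e w ^+ 2)%:E.
  rewrite integralD//; last by apply: integrableD => //; exact: integrableZl.
  rewrite integralD//; [|exact: integrableZl|exact: integrableZl].
  by rewrite !integralZl// e0 mule0 add0e integral_cst// mul1e.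
apply: (@le_trans _ _ (\int[P]_(w in G) (1 + ((l * c)%:E * (e w)%:E
      + (g * c ^+ 2)%:E * (e w ^+ 2)%:E)))).
  apply: ge0_le_integral => //.
  - apply/measurable_EFinP; apply: measurable_funTS.
    apply: measurableT_comp => //; apply: measurable_funM => //.
    by apply: measurableT_comp mce; exact: measurable_cutoff.
  - apply: emeasurable_funD => //.
    by apply: emeasurable_funD; apply: emeasurable_funM => //;
      [case/integrableP : ie'|case/integrableP : ie2].
  - move=> w _; rewrite -!EFinM -!EFinD lee_fin.
    rewrite addrA -[(l * c * _)%R]mulrA -[(g * _ * _)%R]mulrA -exprMn.
    exact: expR_cutoff_le.
rewrite split_quad integral_cst// -[X in X + _]mul1e.
apply: (@le_trans _ _ (1 * P G + (g * c ^+ 2)%:E * (A%:E * P G))).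
  by rewrite leeD2l// lee_wpmul2l// lee_fin mulr_ge0// sqr_ge0.
rewrite -[X in _ <= _ * X](fineK PG) -(fineK PG) -!EFinM -EFinD lee_fin mulrA -mulrDl.
rewrite ler_wpM2r ?fine_ge0// mulrAC; exact: expR_ge1Dx.
Qed.

Lemma sub_sigma_gen_measurable eps (I : set nat) :
  (forall k, I k -> measurable_fun setT (eps k)) ->
  sigma_gen eps I `<=` measurable.
Proof.
move=> meps; apply: smallest_sub; first exact: sigma_algebra_measurable.
by move=> _ [k Ik [B mB <-]]; rewrite -[_ @^-1` _]setTI; exact: meps.
Qed.

Lemma measurable_fun_sigma_gen eps (I : set nat) k : I k ->
  measurable_fun setT (eps k : g_sigma_algebraType (sigma_gens eps I) -> R).
Proof.
by move=> Ik _ B mB; rewrite setTI; apply: sub_gen_smallest; exists k => //; exists B.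
Qed.

Variables (eps : nat -> T -> R) (A : R) (n : nat).
Hypothesis meps : forall k, (1 <= k <= n)%N -> measurable_fun setT (eps k).
Hypothesis mdeps : forall i, (1 <= i <= n)%N ->
  P.-integrable setT (fun w => (eps i w)%:E) /\
  forall G, sigma_gen eps `[1%N, i[ G -> \int[P]_(w in G) (eps i w)%:E = 0.
Hypothesis vareps : forall i, (1 <= i <= n)%N ->
  forall G, sigma_gen eps `[1%N, i[ G ->
  \int[P]_(w in G) (eps i w ^+ 2)%:E <= A%:E * P G.

(** Induction on the number of summands: the last factor is integrated against the product [W] of
    the earlier ones, which is measurable for the past of [eps m.+1]. *)
Lemma integral_expR_sum_cutoff_le (c : nat -> R) (l y : R) (m : nat) :
  (0 < l)%R -> (0 < y)%R -> (l * y < 3)%R -> (m <= n)%N ->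
  \int[P]_w (expR (l * \sum_(1 <= k < m.+1) cutoff y (c k * eps k w)))%:E <=
  (expR (l ^+ 2 / (2 * (1 - l * y / 3)) * A * \sum_(1 <= k < m.+1) c k ^+ 2))%:E.
Proof.
move=> l0 y0 ly; elim: m => [|m IHm] mn.
  under eq_integral do rewrite big_geq// mulr0 expR0.
  by rewrite big_geq// mulr0 expR0 integral_probability_cst.
have m1n : (1 <= m.+1 <= n)%N by [].
have sG : sigma_gen eps `[1%N, m.+1[ `<=` measurable.
  apply: sub_sigma_gen_measurable => k; rewrite /= in_itv/= => /andP[k1 km].
  by apply: meps; apply/andP; split => //; exact: leq_trans (ltnW km) mn.
set g := (l ^+ 2 / _)%R in IHm *.
pose W w := expR (l * \sum_(1 <= k < m.+1) cutoff y (c k * eps k w)).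
pose h w := expR (l * cutoff y (c m.+1 * eps m.+1 w)).
pose K := expR (g * A * c m.+1 ^+ 2).
have mW : measurable_fun setT
    (W : g_sigma_algebraType (sigma_gens eps `[1%N, m.+1[) -> R).
  apply: measurableT_comp => //; apply: measurable_funM => //.
  apply: measurable_sum_nat => k km.
  apply: measurableT_comp; first exact: measurable_cutoff.
  apply: measurable_funM => //; apply: measurable_fun_sigma_gen.
  by rewrite /= in_itv.
have mh : measurable_fun setT h.
  apply: measurableT_comp => //; apply: measurable_funM => //.
  apply: measurableT_comp; first exact: measurable_cutoff.
  by apply: measurable_funM => //; exact: meps.
rewrite [leLHS](_ : _ = \int[P]_w (W w * h w)%:E); last first.
  by apply: eq_integral => w _; rewrite big_nat_recr//= mulrDr expRD.
apply: (@le_trans _ _ (\int[P]_w (W w * K)%:E)).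
  apply: (@ge0_le_integral_sigma _ _ _ _ (sigma_gens eps `[1%N, m.+1[) _ (cst K)) => //.
  - by move=> w; exact: expR_ge0.
  - by move=> w; exact: expR_ge0.
  - move=> G sGG; have [ie ie0] := mdeps _ m1n.
    by apply: integral_expR_cutoff_le => //; [exact: sG|exact: ie0|exact: vareps].
  - by move=> w; exact: expR_ge0.
under eq_integral do rewrite EFinM muleC.
rewrite ge0_integralZl//=.
- rewrite big_nat_recr//= mulrDr expRD EFinM [leRHS]muleC.
  by rewrite lee_wpmul2l ?lee_fin ?expR_ge0//; apply: IHm; exact: ltnW.
- by apply/measurable_EFinP; exact: measurable_fun_sub_sigma mW.
- by move=> w _; rewrite lee_fin expR_ge0.
- by rewrite lee_fin expR_ge0.
Qed.

End bounded_conditional_variance.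

(** With [D = A + x * y / 3], the choice [l = x / D] gives [1 - l * y / 3 = A / D], and the exponent
    equals [- x ^ 2 / (2 * D)]. *)
Lemma bernstein_rate {R : realType} (A x y : R) : 0 <= A -> 0 < x -> 0 < y ->
  exists l, [/\ 0 < l, l * y < 3 &
    - (l * x) + l ^+ 2 / (2 * (1 - l * y / 3)) * A
      <= - x ^+ 2 / (2 * (A + x * y / 3))].
Proof.
move=> A0 x0 y0; have xy0 : 0 < x * y by exact: mulr_gt0.
have [->|An0] := eqVneq A 0.
  (* For [A = 0] the general choice would give [l * y = 3], which is excluded; half of it already
     attains the target exponent [- 3 x / (2 y)]. *)
  exists (3 / (2 * y)); split.
  - by rewrite divr_gt0// mulr_gt0.
  - have -> : 3 / (2 * y) * y = 3 / 2 by field; rewrite gt_eqF.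
    by lra.
  - rewrite mulr0 addr0 add0r le_eqVlt; apply/orP; left; apply/eqP.
    by field; rewrite !gt_eqF.
have A1 : 0 < A by rewrite lt_neqAle eq_sym An0.
have D0 : 0 < A + x * y / 3 by lra.
exists (x / (A + x * y / 3)); split.
- by rewrite divr_gt0.
- by rewrite mulrAC ltr_pdivrMr//; lra.
rewrite le_eqVlt; apply/orP; left; apply/eqP.
by field; rewrite addrK !gt_eqF ?addr_gt0 ?mulr_gt0.
Qed.

(** Unit square sum forces each [|c k| <= 1], so raising the exponent from [2] to [q] only decreases
    each term. *)
Lemma sum_powR_le1 {R : realType} (c : nat -> R) (q : R) (n : nat) : 2 <= q ->
  \sum_(1 <= k < n.+1) c k ^+ 2 = 1 -> \sum_(1 <= k < n.+1) `|c k| `^ q <= 1.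
Proof.
move=> q2 c1; rewrite -[leRHS]c1 big_seq [leRHS]big_seq.
apply: ler_sum => k kn.
have ck1 : `|c k| ^+ 2 <= 1.
  rewrite real_normK ?num_real// -c1 (big_rem k)//= lerDl.
  by apply: sumr_ge0 => i _; exact: sqr_ge0.
have [->|ck0] := eqVneq (c k) 0.
  by rewrite normr0 expr0n powR0//; lra.
rewrite -[c k ^+ 2]real_normK ?num_real// -powR_mulrn//.
apply: ger_powR => //; rewrite normr_gt0 ck0/=.
by rewrite -(@expr_le1 _ 2).
Qed.

Section weighted_tail.
Context d (T : measurableType d) (R : realType) (P : probability T R).
Local Open Scope ereal_scope.
Variables (eps : nat -> T -> R) (A B q : R) (n : nat).
Hypothesis q2 : (2 <= q)%R.
Hypothesis meps : forall k, (1 <= k <= n)%N -> measurable_fun setT (eps k).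
Hypothesis mdeps : forall i, (1 <= i <= n)%N ->
  P.-integrable setT (fun w => (eps i w)%:E) /\
  forall G, sigma_gen eps `[1%N, i[ G -> \int[P]_(w in G) (eps i w)%:E = 0.
Hypothesis vareps : forall i, (1 <= i <= n)%N ->
  forall G, sigma_gen eps `[1%N, i[ G ->
  \int[P]_(w in G) (eps i w ^+ 2)%:E <= A%:E * P G.
Hypothesis momeps : forall i, (1 <= i <= n)%N ->
  \int[P]_w (`|eps i w| `^ q)%:E <= B%:E.

Lemma variance_bound_ge0 : (0 < n)%N -> (0 <= A)%R.
Proof.
move=> n0; have /vareps/(_ setT) : (1 <= 1 <= n)%N by [].
rewrite [P setT](_ : _ = 1); last exact: probability_setT.
rewrite mule1 -lee_fin => Aint; apply: le_trans (Aint _).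
  by apply: integral_ge0 => w _; rewrite lee_fin sqr_ge0.
exact: (@measurableT _ (g_sigma_algebraType (sigma_gens eps `[1%N, 1%N[))).
Qed.

Lemma moment_bound_ge0 : (0 < n)%N -> (0 <= B)%R.
Proof.
move=> n0; have /momeps : (1 <= 1 <= n)%N by [].
rewrite -lee_fin; apply: le_trans.
by apply: integral_ge0 => w _; rewrite lee_fin powR_ge0.
Qed.

(** The inequality [one_le_exp_tail], valid on the event, is integrated: the first term is bounded
    by the exponential moment of the cut sum, the second by Markov's inequality summed over [k]. *)
Lemma weighted_sum_tail (c : nat -> R) (x l y : R) :
  (0 < l)%R -> (0 < y)%R -> (l * y < 3)%R ->
  (\sum_(1 <= k < n.+1) c k ^+ 2 = 1)%R ->
  P [set w | (x <= \sum_(1 <= k < n.+1) c k * eps k w)%R] <=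
  (expR (- (l * x) + l ^+ 2 / (2 * (1 - l * y / 3)) * A) + B / y `^ q)%:E.
Proof.
move=> l0 y0 ly c1.
have q0 : (0 <= q)%R by apply: le_trans q2.
have n0 : (0 < n)%N.
  by rewrite lt0n; apply: contra_eq_neq c1 => ->; rewrite big_geq// eq_sym oner_eq0.
have A0 := variance_bound_ge0 n0; have B0 := moment_bound_ge0 n0.
have knE k : (1 <= k < n.+1)%N -> measurable_fun setT (fun w => c k * eps k w)%R.
  by move=> kn; apply: measurable_funM => //; exact: meps.
set E := [set w | _].
have mE : measurable E.
  rewrite -[E]setTI; apply: measurable_fun_le => //.
  exact: measurable_sum_nat.
pose Z w := expR (l * \sum_(1 <= k < n.+1) cutoff y (c k * eps k w)).
(* The deterministic weight is split off so that the moment bound applies to [eps k] alone. *)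
pose V k w := ((`|c k| / y) `^ q * `|eps k w| `^ q)%R.
have mZ : measurable_fun setT Z.
  apply: measurableT_comp => //; apply: measurable_funM => //.
  apply: measurable_sum_nat => k kn.
  by apply: measurableT_comp (knE _ kn); exact: measurable_cutoff.
have mV0 k : (1 <= k < n.+1)%N -> measurable_fun setT (fun w => `|eps k w| `^ q)%R.
  move=> kn; apply: (@measurableT_comp _ _ _ _ _ _ (@powR R ^~ q)) => //.
  by apply: measurableT_comp => //; exact: meps.
have mV k : (1 <= k < n.+1)%N -> measurable_fun setT (V k).
  by move=> kn; apply: measurable_funM => //; exact: mV0.
have V0 k w : (0 <= V k w)%R by rewrite mulr_ge0 ?powR_ge0.
have EZV w : (\1_E w <= expR (- (l * x)) * Z w + \sum_(1 <= k < n.+1) V k w)%R.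
  rewrite indicE; case: (boolP (w \in E)) => [/set_mem wE|_] /=.
    apply: le_trans (one_le_exp_tail _ _ _ _ _ _ l0 y0 q0 wE) _.
    rewrite lerD2l; apply: ler_sum => k _.
    by rewrite /V -powRM ?divr_ge0 ?(ltW y0)// normrM mulrAC.
  by rewrite addr_ge0 ?mulr_ge0 ?expR_ge0// sumr_ge0.
have -> : P E = \int[P]_w (\1_E w)%:E by rewrite integral_indic// setIT.
apply: (@le_trans _ _ (\int[P]_w ((expR (- (l * x)))%:E * (Z w)%:E
    + \sum_(1 <= k < n.+1) (V k w)%:E))).
  apply: ge0_le_integral => //.
  - by apply/measurable_EFinP; exact: measurable_indic.
  - apply: emeasurable_funD.
      by apply: emeasurable_funM => //; exact/measurable_EFinP.
    under eq_fun do rewrite sumEFin.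
    by apply/measurable_EFinP; exact: measurable_sum_nat.
  - by move=> w _; rewrite sumEFin -EFinM -EFinD lee_fin.
rewrite ge0_integralD//; last 4 first.
- by move=> w _; rewrite mule_ge0// lee_fin expR_ge0.
- by apply: emeasurable_funM => //; exact/measurable_EFinP.
- by move=> w _; apply: sume_ge0 => k _; rewrite lee_fin.
- under eq_fun do rewrite sumEFin.
  by apply/measurable_EFinP; exact: measurable_sum_nat.
rewrite ge0_integralZl//; last 2 first.
- exact/measurable_EFinP.
- by move=> w _; rewrite lee_fin expR_ge0.
rewrite ge0_integral_sum_nat//; last first.
  by move=> k kn; apply/measurable_EFinP; exact: mV.
rewrite EFinD leeD//.
  rewrite expRD EFinM lee_wpmul2l ?lee_fin ?expR_ge0//.
  have := @integral_expR_sum_cutoff_le _ _ _ P eps A n meps mdeps vareps c l y n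
    l0 y0 ly (leqnn n).
  by rewrite c1 mulr1.
apply: (@le_trans _ _ (\sum_(1 <= k < n.+1) ((`|c k| `^ q / y `^ q * B)%R)%:E)).
  rewrite big_seq [leRHS]big_seq; apply: lee_sum => k; rewrite mem_index_iota => kn.
  under eq_integral do rewrite EFinM.
  rewrite ge0_integralZl//=; last 2 first.
  - by apply/measurable_EFinP; exact: mV0.
  - by rewrite lee_fin powR_ge0.
  rewrite powRM ?invr_ge0 ?(ltW y0)// -powR_inv1 ?(ltW y0)// powRAC powR_inv1 ?powR_ge0//.
  rewrite [leRHS]EFinM lee_wpmul2l ?momeps//.
  by rewrite lee_fin mulr_ge0 ?invr_ge0 ?powR_ge0.
rewrite sumEFin lee_fin -!mulr_suml mulrAC ler_wpM2r ?invr_ge0 ?powR_ge0//.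
by rewrite ler_piMl// sum_powR_le1.
Qed.

End weighted_tail.

(** * Polynomial decay of the bound at deviations of order [sqrt n] *)

(** Since [expR t >= t ^ (m + 1) / (m + 1)!], it suffices to take [m] with [a <= b * (m + 1)]; then
    [r >= 1] gives [r ^ a <= r ^ (b * (m + 1))]. *)
Lemma expR_le_powR {R : realType} (K b a : R) : 0 < K -> 0 < b ->
  exists C, 0 < C /\ forall r, 1 <= r -> expR (- (K * r `^ b)) <= C / r `^ a.
Proof.
move=> K0 b0; pose m := Num.truncn (a / b).
have mab : a <= b * m.+1%:R.
  by rewrite mulrC -ler_pdivrMr// ltW// truncnS_gt.
exists (m.+1`!%:R / K ^+ m.+1); split.
  by rewrite divr_gt0 ?exprn_gt0// ltr0n fact_gt0.
move=> r r1; have r0 : 0 < r by exact: lt_le_trans r1.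
have t0 : 0 < K * r `^ b by rewrite mulr_gt0// powR_gt0.
have et : (K * r `^ b) ^+ m.+1 / m.+1`!%:R <= expR (K * r `^ b).
  by apply: le_trans (expR_ge1Dxn m (ltW t0)); rewrite lerDr.
rewrite expRN -[leRHS]invrK lef_pV2 ?posrE ?expR_gt0//; last first.
  by rewrite invr_gt0 !divr_gt0 ?exprn_gt0 ?powR_gt0// ltr0n fact_gt0.
apply: le_trans et.
have -> : (m.+1`!%:R / K ^+ m.+1 / r `^ a)^-1 = K ^+ m.+1 * r `^ a / m.+1`!%:R :> R.
  by rewrite !invfM !invrK -mulrA mulrC.
rewrite ler_wpM2r ?invr_ge0// exprMn ler_wpM2l ?exprn_ge0 ?(ltW K0)//.
by rewrite -powR_mulrn ?powR_ge0// -powRrM ler_powR.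
Qed.

Lemma fuk_rate {R : realType} (A B p delta x : R) :
  0 <= A -> 0 <= B -> 2 <= p -> 0 < delta -> 0 < x ->
  exists c, 0 < c /\ forall r, 1 <= r ->
    expR (- (Num.sqrt r * x) ^+ 2 / (2 * (A +
      (Num.sqrt r * x) `^ ((2 * p + delta) / (p + delta)) / 3)))
    + B / (Num.sqrt r * x) `^ p <= c / r `^ (p / 2).
Proof.
move=> A0 B0 p2 d0 x0; set a := (2 * p + delta) / (p + delta).
have pd0 : 0 < p + delta by lra.
have a0 : 0 < a by rewrite divr_gt0//; lra.
(* The exponential term decays in [r] because [a < 2], which is where [delta > 0] enters. *)
have b0 : 0 < 1 - a / 2.
  rewrite (_ : _ - _ = delta / (2 * (p + delta))) ?divr_gt0 ?mulr_gt0//.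
  by rewrite /a; field; rewrite gt_eqF.
pose D := A + x `^ a / 3.
have D0 : 0 < D by rewrite ltr_wpDl// divr_gt0// powR_gt0.
have K0 : 0 < x ^+ 2 / (2 * D) by rewrite divr_gt0 ?exprn_gt0// mulr_gt0.
have [C [C0 HC]] := expR_le_powR _ _ (p / 2) K0 b0.
exists (C + B / x `^ p); split.
  by rewrite ltr_pwDl// divr_ge0// powR_ge0.
move=> r r1; have r0 : 0 < r by exact: lt_le_trans r1.
have sq0 : 0 <= Num.sqrt r by exact: sqrtr_ge0.
have sqrE b : Num.sqrt r `^ b = r `^ (b / 2).
  by rewrite -powR12_sqrt ?(ltW r0)// -powRrM mulrC.
rewrite !powRM ?(ltW x0)// !sqrE [leRHS]mulrDl lerD//; last first.
  by rewrite le_eqVlt invfM mulrA mulrAC eqxx.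
apply: le_trans (HC _ r1); rewrite ler_expR exprMn sqr_sqrtr ?(ltW r0)//.
(* This allows [A <= r ^ (a / 2) * A], so that [r ^ (a / 2)] factors out of the denominator and
   leaves [r ^ (1 - a / 2)] in the exponent. *)
have ra1 : 1 <= r `^ (a / 2).
  by rewrite -[X in X <= _](powRr0 r); apply: ler_powR => //; apply: divr_ge0 => //; exact: ltW.
have ra0 : 0 < r `^ (a / 2) by exact: lt_le_trans ra1.
rewrite powRB; last by apply/implyP => _; rewrite gt_eqF.
rewrite powRr1 ?(ltW r0)// mulNr lerN2.
have -> : x ^+ 2 / (2 * D) * (r / r `^ (a / 2))
    = r * x ^+ 2 / (2 * (r `^ (a / 2) * D)).
  by field; rewrite !gt_eqF.
rewrite ler_wpM2l ?mulr_ge0 ?exprn_ge0 ?(ltW r0) ?(ltW x0)//.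
rewrite lef_pV2 ?posrE ?mulr_gt0//; last first.
  by rewrite ltr_wpDl// divr_gt0// mulr_gt0// powR_gt0.
rewrite ler_pM2l// mulrDr mulrA lerD2r.
by rewrite ler_peMl.
Qed.

(** * The stated bound for a frozen design, then for the least squares estimator *)

Section weighted_tail_moment.
Context d (T : measurableType d) (R : realType) (P : probability T R).
Local Open Scope ereal_scope.

Lemma fixed_design_tail (eps : nat -> T -> R) (p delta A B : R) (n : nat)
    (c : nat -> R) (x : R) :
  (2 <= p)%R -> (0 < delta)%R ->
  (forall k, (1 <= k <= n)%N -> measurable_fun setT (eps k)) ->
  (forall i, (1 <= i <= n)%N ->
    P.-integrable setT (fun w => (eps i w)%:E) /\
    forall G, sigma_gen eps `[1%N, i[ G -> \int[P]_(w in G) (eps i w)%:E = 0) ->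
  (forall i, (1 <= i <= n)%N -> forall G, sigma_gen eps `[1%N, i[ G ->
    \int[P]_(w in G) (eps i w ^+ 2)%:E <= A%:E * P G) ->
  (forall i, (1 <= i <= n)%N ->
    \int[P]_w (`|eps i w| `^ (p + delta))%:E <= B%:E) ->
  (0 <= A)%R -> (0 < x)%R -> (\sum_(1 <= k < n.+1) c k ^+ 2 = 1)%R ->
  P [set w | (x <= \sum_(1 <= k < n.+1) c k * eps k w)%R] <=
  (expR (- (x ^+ 2) / (2 * (A + x `^ ((2 * p + delta) / (p + delta)) / 3)))
    + B / x `^ p)%:E.
Proof.
move=> p2 d0 meps mdeps vareps momeps A0 x0 c1.
have q0 : (0 < p + delta)%R by lra.
pose y := (x `^ (p / (p + delta)))%R.
have y0 : (0 < y)%R by exact: powR_gt0.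
have [l [l0 ly lb]] := bernstein_rate A x y A0 x0 y0.
have q2 : (2 <= p + delta)%R by lra.
have := @weighted_sum_tail _ _ _ P eps A B (p + delta) n q2 meps mdeps vareps
  momeps c x l y l0 y0 ly c1.
move/le_trans; apply; rewrite lee_fin -powRrM divfK ?gt_eqF// lerD2r ler_expR.
apply: le_trans lb _; rewrite -[X in (X * y)%R](powRr1 (ltW x0)) -powRD; last first.
  by rewrite (gt_eqF x0) implybT.
rewrite (_ : 1 + p / (p + delta) = (2 * p + delta) / (p + delta))%R//.
by field; rewrite gt_eqF.
Qed.

End weighted_tail_moment.

Section least_squares_tail.
Context {d} {T : measurableType d} {R : realType} {P : probability T R}.
Context {theta : R} {phi eps : nat -> T -> R} {p delta A B : R} {n : nat}.
Hypothesis hyps : model_hyps P phi eps p delta A B n.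

Lemma Ssq_ge0 w : 0 <= Ssq phi n w.
Proof. by apply: sumr_ge0 => k _; exact: sqr_ge0. Qed.

(** For [n = 0] the sum of squares is the empty sum, nowhere positive, against its almost sure
    positivity. The signs of [A] and [B] are then read off the index [1]. *)
Lemma model_size_gt0 : (0 < n)%N.
Proof.
case: hyps => _ [_ [_ [_ [_ [_ [_ [N [mN N0 SN]]]]]]]].
rewrite lt0n; apply/eqP => n0.
have NT : N = setT.
  by apply/seteqP; split => // w _; apply: SN; rewrite /= /Ssq n0 big_geq// ltxx.
move: N0; rewrite NT [P _](_ : _ = 1%E); last exact: probability_setT.
by move/eqP; rewrite onee_eq0.
Qed.

Lemma model_A_ge0 : 0 <= A.
Proof.
case: hyps => _ [_ [_ [_ [_ [vareps _]]]]].
exact: variance_bound_ge0 vareps model_size_gt0.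
Qed.

Lemma model_B_ge0 : 0 <= B.
Proof.
case: hyps => _ [_ [_ [_ [_ [_ [momeps _]]]]]].
exact: moment_bound_ge0 momeps model_size_gt0.
Qed.

Lemma theta_hat_errorE w : 0 < Ssq phi n w ->
  (theta_hat theta phi eps n w - theta) * Num.sqrt (Ssq phi n w) =
  (\sum_(1 <= k < n.+1) phi k w * eps k w) / Num.sqrt (Ssq phi n w).
Proof.
move=> S0; have r0 : 0 < Num.sqrt (Ssq phi n w) by rewrite sqrtr_gt0.
have -> : theta_hat theta phi eps n w =
    theta + (\sum_(1 <= k < n.+1) phi k w * eps k w) / Ssq phi n w.
  apply: (mulIf (lt0r_neq0 S0)); rewrite /theta_hat mulrDl !divfK ?lt0r_neq0//.
  rewrite /Ssq mulr_sumr -big_split/=.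
  by apply: eq_bigr => k _; rewrite /Xobs; ring.
rewrite addrC addKr -{1}(sqr_sqrtr (Ssq_ge0 w)).
by field; rewrite gt_eqF.
Qed.

(** Clearing the division gives an event in which design and noise enter through finite sums. Where
    [Ssq] vanishes the left condition reads [x <= 0], so the two events coincide at every point. *)
Lemma theta_hat_eventE (x : R) (s : bool) : 0 < x ->
  [set w | x <= (-1) ^+ s * (theta_hat theta phi eps n w - theta)
                 * Num.sqrt (Ssq phi n w)] =
  [set w | 0 < Ssq phi n w /\
     x * Num.sqrt (Ssq phi n w) <=
     \sum_(1 <= k < n.+1) (-1) ^+ s * phi k w * eps k w].
Proof.
move=> x0; apply/seteqP.
have E w : 0 < Ssq phi n w ->
    (x <= (-1) ^+ s * (theta_hat theta phi eps n w - theta) * Num.sqrt (Ssq phi n w))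
    = (x * Num.sqrt (Ssq phi n w) <= \sum_(1 <= k < n.+1) (-1) ^+ s * phi k w * eps k w).
  move=> S0; rewrite -mulrA theta_hat_errorE// mulrA ler_pdivlMr ?sqrtr_gt0//.
  by rewrite mulr_sumr; under eq_bigr do rewrite mulrA.
split => w /=; last by case=> S0; rewrite E.
have [S0|S0] := ltP 0 (Ssq phi n w); first by rewrite E.
have -> : Ssq phi n w = 0 by apply/eqP; rewrite eq_le S0 Ssq_ge0.
by rewrite sqrtr0 mulr0 leNgt x0.
Qed.

Lemma theta_hat_tail (x : R) (s : bool) : 2 <= p -> 0 < delta -> 0 < x ->
  (P [set w | (x <= (-1) ^+ s * (theta_hat theta phi eps n w - theta)
                 * Num.sqrt (Ssq phi n w))%R]
  <= (expR (- (x ^+ 2) / (2 * (A + x `^ ((2 * p + delta) / (p + delta)) / 3)))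
      + B / x `^ p)%:E)%E.
Proof.
move=> p2 d0 x0; rewrite theta_hat_eventE//.
case: hyps => mphi [meps [_ [indep [mdeps [vareps [momeps _]]]]]].
have inI k : (1 <= k < n.+1)%N -> [set` `[1%N, n]] k by rewrite /= in_itv.
have mI (f : nat -> T -> R) : (forall k, (1 <= k <= n)%N -> measurable_fun setT (f k)) ->
    sigma_gen f `[1%N, n] `<=` measurable.
  by move=> mf; apply: sub_sigma_gen_measurable => k /=; rewrite in_itv; exact: mf.
pose T1 := g_sigma_algebraType (sigma_gens phi `[1%N, n]).
pose T2 := g_sigma_algebraType (sigma_gens eps `[1%N, n]).
have m1 k : (1 <= k < n.+1)%N -> measurable_fun setT (fun z : T1 * T2 => phi k z.1).
  move=> kn; apply: (measurableT_comp _ measurable_fst).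
  exact: measurable_fun_sigma_gen (inI _ kn).
have m2 k : (1 <= k < n.+1)%N -> measurable_fun setT (fun z : T1 * T2 => eps k z.2).
  move=> kn; apply: (measurableT_comp _ measurable_snd).
  exact: measurable_fun_sigma_gen (inI _ kn).
have mS : measurable_fun setT (fun z : T1 * T2 => Ssq phi n z.1).
  by apply: measurable_sum_nat => k kn; apply: measurable_funX; exact: m1.
(* The event is the diagonal of a set of pairs: the first coordinate carries the design, the second
   the noise. *)
apply: (@independent_sigma_diag_le _ _ _ P (sigma_gens phi `[1%N, n])
  (sigma_gens eps `[1%N, n])
  [set z | 0 < Ssq phi n z.1 /\ x * Num.sqrt (Ssq phi n z.1) <=
     \sum_(1 <= k < n.+1) (-1) ^+ s * phi k z.1 * eps k z.2]).
- exact: mI.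
- exact: mI.
- exact: indep.
- apply: measurableI.
  + rewrite -[X in measurable X]setTI.
    have := @measurable_fun_ltr _ _ _ setT (cst 0) _ (measurable_cst _) mS.
    by move=> /(_ measurableT [set true]); apply.
  + rewrite -[X in measurable X]setTI; apply: measurable_fun_le => //.
    * apply: measurable_funM => //; apply: measurableT_comp mS.
      by apply: continuous_measurable_fun; exact: sqrt_continuous.
    * apply: measurable_sum_nat => k kn; apply: measurable_funM; last exact: m2.
      by apply: measurable_funM => //; exact: m1.
(* With the design frozen at [u], the section is empty if [Ssq] vanishes; otherwise division by its
   square root produces weights of unit square sum. *)
- move=> u; have [S0|S0] := ltP 0 (Ssq phi n u); last first.
    rewrite (_ : [set v | _] = set0); last first.
      by apply/seteqP; split => // v [/=]; rewrite ltNge S0.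
    rewrite measure0 lee_fin addr_ge0 ?expR_ge0// divr_ge0 ?powR_ge0//.
    exact: model_B_ge0.
  have r0 : 0 < Num.sqrt (Ssq phi n u) by rewrite sqrtr_gt0.
  rewrite (_ : [set v | _] = [set v | x <= \sum_(1 <= k < n.+1)
      ((-1) ^+ s * phi k u / Num.sqrt (Ssq phi n u)) * eps k v]); last first.
    apply/seteqP; split => v /=.
      move=> [_]; rewrite -ler_pdivlMr// mulr_suml.
      by under eq_bigr do rewrite mulrAC.
    move=> H; split => //; move: H.
    under eq_bigr do rewrite mulrAC.
    by rewrite -mulr_suml ler_pdivlMr.
  apply: fixed_design_tail => //; first exact: model_A_ge0.
  under eq_bigr do rewrite !exprMn exprVn sqr_sqrtr ?Ssq_ge0// sqrr_sign mul1r.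
  by rewrite -mulr_suml divff// gt_eqF.
Qed.

End least_squares_tail.

Theorem theorem3p4 (d : measure_display) (T : measurableType d) (R : realType)
    (P : probability T R) (theta : R) (phi eps : nat -> T -> R)
    (p delta A B : R) (hp : 2 <= p) (hdelta : 0 < delta) :
  (forall n : nat, model_hyps P phi eps p delta A B n ->
    forall (x : R) (s : bool), 0 < x ->
      (P [set w | (x <= (-1) ^+ s * (theta_hat theta phi eps n w - theta)
                        * Num.sqrt (Ssq phi n w))%R]
      <= (expR (- (x ^+ 2) / (2 * (A + x `^ ((2 * p + delta) / (p + delta)) / 3)))
          + B / x `^ p)%:E)%E)
  /\
  ((forall n : nat, (0 < n)%N -> model_hyps P phi eps p delta A B n) ->
    forall (x : R) (s : bool), 0 < x ->
      exists c : R, 0 < c /\ exists N : nat, forall n : nat, (N <= n)%N ->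
        (P [set w | (Num.sqrt n%:R * x <= (-1) ^+ s * (theta_hat theta phi eps n w - theta)
                        * Num.sqrt (Ssq phi n w))%R]
        <= (c / n%:R `^ (p / 2))%:E)%E).
Proof.
split=> [n hyps x s x0|hyps x s x0]; first exact: theta_hat_tail.
have hyps1 := hyps 1%N isT.
(* The constants are common to all sample sizes, so size [1] determines their signs and [c] is
   chosen before [n]. *)
have A0 := model_A_ge0 hyps1; have B0 := model_B_ge0 hyps1.
have [c [c0 Hc]] := fuk_rate A B p delta x A0 B0 hp hdelta x0.
exists c; split => //; exists 1%N => n n1.
apply: le_trans (theta_hat_tail (hyps n n1) _ s hp hdelta _) _.
  by rewrite mulr_gt0// sqrtr_gt0 ltr0n.
by rewrite lee_fin; apply: Hc; rewrite ler1n.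
Qed.
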